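(* Let $a,b,m_1,n_1$ be non-zero real parameters, let $p,q$ be arbitrary real parameters, and consider the (2+1)-dimensional inhomogeneous Fisher-Kolmogorov equation $$u_t = a u - M(x)N(y)\,u^2 + b\,(u_{xx}+u_{yy}),\qquad M(x)=m_1e^{px},\quad N(y)=n_1e^{qy},$$ for $u=u(t,x,y)$. The complete classification of the point symmetries admitted by this equation is as follows. Case 1. For arbitrary parameters (that is, when $a\neq -b(p^2+q^2)$), the Lie algebra of infinitesimal generators of point symmetries is spanned by $$X_1=\partial_t,$$ $$X_2=\partial_x-p\,u\,\partial_u,$$ $$X_{2'}=\partial_y-q\,u\,\partial_u,$$ $$X_3=(-y+2bqt)\,\partial_x+(x-2bpt)\,\partial_y+(py-qx)\,u\,\partial_u.$$ Case 2. For $a=-b(p^2+q^2)$, the Lie algebra of infinitesimal generators of point symmetries is spanned by $X_1,X_2,X_{2'},X_3$ (given by the formulas of Case 1) and $$X_4=pqt\,\partial_t+\left(\tfrac12 pqx+bp^2qt-\tfrac12 q\right)\partial_x+\left(\tfrac12 pqy+bpq^2t-\tfrac12 p\right)\partial_y-\left(b(p^2+q^2)pqt+\tfrac12p^2qx+\tfrac12pq^2y\right)u\,\partial_u.$$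
   Context: A point symmetry generator (infinitesimal generator) of the equation is a smooth vector field $$X=\tau(t,x,y,u)\,\partial_t+\xi^x(t,x,y,u)\,\partial_x+\xi^y(t,x,y,u)\,\partial_y+\phi(t,x,y,u)\,\partial_u$$ on the space of variables $(t,x,y,u)$ satisfying the infinitesimal invariance criterion $$\mathrm{pr}^{(2)}X(\Delta)=0\quad\text{whenever}\quad \Delta=0,\qquad \Delta=u_t-au+M(x)N(y)u^2-b(u_{xx}+u_{yy}),$$ where $t,x,y,u$ and the derivatives of $u$ up to second order are regarded as independent jet coordinates (so the criterion is required at all points of the second-order jet space with $\Delta=0$). The second prolongation, restricted to the derivatives needed, is $$\mathrm{pr}^{(2)}X=X+\phi_{(t)}\frac{\partial}{\partial u_t}+\phi_{(x)}\frac{\partial}{\partial u_x}+\phi_{(y)}\frac{\partial}{\partial u_y}+\phi_{(xx)}\frac{\partial}{\partial u_{xx}}+\phi_{(xy)}\frac{\partial}{\partial u_{xy}}+\phi_{(yy)}\frac{\partial}{\partial u_{yy}},$$ with, for $i\in\{t,x,y\}$, $$\phi_{(i)}=D_i\phi-u_tD_i\tau-u_xD_i\xi^x-u_yD_i\xi^y,$$ and $$\phi_{(xx)}=D_x\phi_{(x)}-u_{tx}D_x\tau-u_{xx}D_x\xi^x-u_{xy}D_x\xi^y,$$ $$\phi_{(xy)}=D_y\phi_{(x)}-u_{tx}D_y\tau-u_{xx}D_y\xi^x-u_{xy}D_y\xi^y,$$ $$\phi_{(yy)}=D_y\phi_{(y)}-u_{ty}D_y\tau-u_{xy}D_y\xi^x-u_{yy}D_y\xi^y,$$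 where $D_t,D_x,D_y$ are the total derivative operators. ''Complete classification'' means that in each case the real vector space of all point symmetry generators is the span of the listed vector fields.
   Formalization: In Case 2, that every generator lies in the span of X_1, X_2, X_{2'}, X_3, X_4 is claimed only for p, q both non-zero: if pq = 0, X_4 lies in the span of X_2, X_{2'} and a further scaling symmetry is missed. That the span consists of generators is proved for all p, q. *)

(* Defs.v *)
From Stdlib Require Import Reals List.
From Coquelicot Require Import Coquelicot.
Import ListNotations.
Open Scope R_scope.

Definition fn4 := R -> R -> R -> R -> R.

Definition pd_t (f : fn4) : fn4 := fun t x y u => Derive (fun s => f s x y u) t.
Definition pd_x (f : fn4) : fn4 := fun t x y u => Derive (fun s => f t s y u) x.
Definition pd_y (f : fn4) : fn4 := fun t x y u => Derive (fun s => f t x s u) y.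
Definition pd_u (f : fn4) : fn4 := fun t x y u => Derive (fun s => f t x y s) u.

Definition jointly_continuous (f : fn4) : Prop :=
  forall z : R * R * R * R, continuous (fun '(t, x, y, u) => f t x y u) z.

Definition has_partials (f : fn4) : Prop :=
  forall t x y u : R,
    ex_derive (fun s => f s x y u) t /\ ex_derive (fun s => f t s y u) x /\
    ex_derive (fun s => f t x s u) y /\ ex_derive (fun s => f t x y s) u.

(** [Ck n f]: all iterated partial derivatives of [f] of order at most [n]
    exist and are jointly continuous on R^4. *)
Fixpoint Ck (n : nat) (f : fn4) : Prop :=
  jointly_continuous f /\
  match n with
  | O => True
  | S m => has_partials f /\
           Ck m (pd_t f) /\ Ck m (pd_x f) /\ Ck m (pd_y f) /\ Ck m (pd_u f)
  end.

Definition smooth (f : fn4) : Prop := forall n : nat, Ck n f.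

(** tau d_t + xix d_x + xiy d_y + phi d_u *)
Record vfield := VField { tau : fn4; xix : fn4; xiy : fn4; phi : fn4 }.

Definition smooth_vfield (V : vfield) : Prop :=
  smooth (tau V) /\ smooth (xix V) /\ smooth (xiy V) /\ smooth (phi V).

Definition vzero : vfield :=
  VField (fun _ _ _ _ => 0) (fun _ _ _ _ => 0)
         (fun _ _ _ _ => 0) (fun _ _ _ _ => 0).

Definition vadd (V W : vfield) : vfield :=
  VField (fun t x y u => tau V t x y u + tau W t x y u)
         (fun t x y u => xix V t x y u + xix W t x y u)
         (fun t x y u => xiy V t x y u + xiy W t x y u)
         (fun t x y u => phi V t x y u + phi W t x y u).

Definition vscale (c : R) (V : vfield) : vfield :=
  VField (fun t x y u => c * tau V t x y u)
         (fun t x y u => c * xix V t x y u)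
         (fun t x y u => c * xiy V t x y u)
         (fun t x y u => c * phi V t x y u).

Inductive in_span : list vfield -> vfield -> Prop :=
  | span_nil : in_span [] vzero
  | span_cons (c : R) (V : vfield) (Vs : list vfield) (W : vfield) :
      in_span Vs W -> in_span (V :: Vs) (vadd (vscale c V) W).

Inductive coord :=
  | c_t | c_x | c_y | c_u
  | c_ut | c_ux | c_uy
  | c_utt | c_utx | c_uty | c_uxx | c_uxy | c_uyy.

Scheme Equality for coord.

Definition jet := coord -> R.

Definition upd (j : jet) (c : coord) (s : R) : jet :=
  fun c' => if coord_eq_dec c c' then s else j c'.

Definition pd (c : coord) (F : jet -> R) : jet -> R :=
  fun j => Derive (fun s => F (upd j c s)) (j c).

Definition lift (f : fn4) : jet -> R := fun j => f (j c_t) (j c_x) (j c_y) (j c_u).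

Inductive indep := i_t | i_x | i_y.

Definition base (i : indep) : coord :=
  match i with i_t => c_t | i_x => c_x | i_y => c_y end.

Definition jet1 (i : indep) : coord :=
  match i with i_t => c_ut | i_x => c_ux | i_y => c_uy end.

Definition jet2 (i k : indep) : coord :=
  match i, k with
  | i_t, i_t => c_utt
  | i_t, i_x | i_x, i_t => c_utx
  | i_t, i_y | i_y, i_t => c_uty
  | i_x, i_x => c_uxx
  | i_x, i_y | i_y, i_x => c_uxy
  | i_y, i_y => c_uyy
  end.

(** Total derivative D_i of a function of order at most one: the terms in the
    derivatives of [F] along second-order coordinates, which would involve
    third-order coordinates, are absent.  It is only applied to such [F]. *)
Definition total_D (i : indep) (F : jet -> R) : jet -> R :=
  fun j =>
    pd (base i) F j + j (jet1 i) * pd c_u F j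
    + j (jet2 i i_t) * pd c_ut F j
    + j (jet2 i i_x) * pd c_ux F j
    + j (jet2 i i_y) * pd c_uy F j.

Definition phi1 (V : vfield) (i : indep) : jet -> R :=
  fun j =>
    total_D i (lift (phi V)) j
    - j c_ut * total_D i (lift (tau V)) j
    - j c_ux * total_D i (lift (xix V)) j
    - j c_uy * total_D i (lift (xiy V)) j.

(** [phi2 V i k] is phi_(ik), obtained from phi_(i) by means of D_k. *)
Definition phi2 (V : vfield) (i k : indep) : jet -> R :=
  fun j =>
    total_D k (phi1 V i) j
    - j (jet2 i i_t) * total_D k (lift (tau V)) j
    - j (jet2 i i_x) * total_D k (lift (xix V)) j
    - j (jet2 i i_y) * total_D k (lift (xiy V)) j.

(** The second prolongation as a derivation, without the d/du_tt, d/du_tx and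
    d/du_ty terms: they annihilate [FKDelta], the only function [pr2] is applied to. *)
Definition pr2 (V : vfield) (F : jet -> R) : jet -> R :=
  fun j =>
    lift (tau V) j * pd c_t F j
    + lift (xix V) j * pd c_x F j
    + lift (xiy V) j * pd c_y F j
    + lift (phi V) j * pd c_u F j
    + phi1 V i_t j * pd c_ut F j
    + phi1 V i_x j * pd c_ux F j
    + phi1 V i_y j * pd c_uy F j
    + phi2 V i_x i_x j * pd c_uxx F j
    + phi2 V i_x i_y j * pd c_uxy F j
    + phi2 V i_y i_y j * pd c_uyy F j.

Definition FKDelta (a b : R) (M N : R -> R) : jet -> R :=
  fun j =>
    j c_ut - a * j c_u + M (j c_x) * N (j c_y) * (j c_u) ^ 2
    - b * (j c_uxx + j c_uyy).

Definition symmetry_generator (a b : R) (M N : R -> R) (V : vfield) : Prop :=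
  smooth_vfield V /\
  forall j : jet, FKDelta a b M N j = 0 -> pr2 V (FKDelta a b M N) j = 0.

Definition X1 : vfield :=
  VField (fun _ _ _ _ => 1) (fun _ _ _ _ => 0)
         (fun _ _ _ _ => 0) (fun _ _ _ _ => 0).

Definition X2 (p : R) : vfield :=
  VField (fun _ _ _ _ => 0) (fun _ _ _ _ => 1)
         (fun _ _ _ _ => 0) (fun t x y u => - (p * u)).

Definition X2' (q : R) : vfield :=
  VField (fun _ _ _ _ => 0) (fun _ _ _ _ => 0)
         (fun _ _ _ _ => 1) (fun t x y u => - (q * u)).

Definition X3 (b p q : R) : vfield :=
  VField (fun _ _ _ _ => 0)
         (fun t x y u => - y + 2 * b * q * t)
         (fun t x y u => x - 2 * b * p * t)
         (fun t x y u => (p * y - q * x) * u).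

(** If p q = 0, then [X4] is a linear combination of [X2] and [X2'], whereas
    for a = - b (p^2 + q^2) the scaling
    t d_t + (x / 2 + b p t) d_x + (y / 2 + b q t) d_y
      - (1 + b (p^2 + q^2) t + p x / 2 + q y / 2) u d_u
    is always a symmetry.  So X1, X2, X2', X3, X4 generate the whole algebra
    only if p q <> 0. *)
Definition X4 (b p q : R) : vfield :=
  VField (fun t x y u => p * q * t)
         (fun t x y u => / 2 * p * q * x + b * p ^ 2 * q * t - / 2 * q)
         (fun t x y u => / 2 * p * q * y + b * p * q ^ 2 * t - / 2 * p)
         (fun t x y u =>
            - (b * (p ^ 2 + q ^ 2) * p * q * t + / 2 * p ^ 2 * q * x
               + / 2 * p * q ^ 2 * y) * u).

(* Main.v *)
Require Import Defs.
From Stdlib Require Import Reals List Lra FunctionalExtensionality.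
From Coquelicot Require Import Coquelicot.
Import ListNotations.
Open Scope R_scope.

(** Substituting u = exp (- (p x + q y)) w and passing to the frame moving with
    velocity 2 b (p, q) turns the equation into
    w_t = k w - m1 n1 w^2 + b (w_xx + w_yy) with k = a + b (p^2 + q^2).  Its
    symmetries are the translations, the rotations of the plane and, only for
    k = 0, the parabolic scaling.  In the original variables these form the
    family [FK_field], in which [t1] is the coefficient of the scaling, and the
    symmetry algebra is exactly the set of its members with k t1 = 0
    ([symmetry_normal_form], [symmetry_FK_field]).  This holds for all p and q;
    the theorem then only compares the family with the two spans.  For k = 0,
    X4 is p q times the scaling plus multiples of X2 and X2', so that it
    supplies the scaling if p q <> 0.

    That every symmetry belongs to the family is proved in the original
    variables.  The criterion is polynomial in the jet coordinates once u_t is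
    eliminated, and its coefficients are the determining equations.  They say
    that tau depends on t only, that (xi, eta) does not depend on u and is
    conformal in (x, y) with factor tau' / 2, and that phi is affine in u.  So
    xi and eta are known up to functions of t ([conformal_field_form]); the
    coefficient of u^2 in the remaining equation expresses phi_u by tau', xi
    and eta, and the coefficients of u_x and u_y then give ordinary
    differential equations in t ([coefficients_of_symmetry]).  The
    coefficients of u and of 1 determine phi at u = 0 and force k t1 = 0.

    The mixed derivatives phi_ux and phi_xu that meet in the coefficient of u_x
    are identified by means of the affinity of phi in u
    ([pd_u_partial_affine]). *)

(** * Total derivatives and the second prolongation *)

Definition partial (i : indep) : fn4 -> fn4 :=
  match i with i_t => pd_t | i_x => pd_x | i_y => pd_y end.

Lemma upd_self (j : jet) (c : coord) : upd j c (j c) = j.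
Proof.
  apply functional_extensionality; intro c'.
  unfold upd; destruct (coord_eq_dec c c') as [->|]; reflexivity.
Qed.

(** The differentiability of [F] along every jet coordinate is carried along with
    the value, so that the rules below compose without side conditions. *)
Definition has_total_D (k : indep) (F : jet -> R) (j : jet) (l : R) : Prop :=
  (forall c, ex_derive (fun s => F (upd j c s)) (j c)) /\ total_D k F j = l.

Lemma has_total_D_plus k F G j l m :
  has_total_D k F j l -> has_total_D k G j m ->
  has_total_D k (fun j => F j + G j) j (l + m).
Proof.
  intros [exF <-] [exG <-]; split.
  - intro c; exact (ex_derive_plus _ _ _ (exF c) (exG c)).
  - unfold total_D, pd.
    rewrite !Derive_plus by auto. ring.
Qed.

Lemma has_total_D_minus k F G j l m :
  has_total_D k F j l -> has_total_D k G j m ->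
  has_total_D k (fun j => F j - G j) j (l - m).
Proof.
  intros [exF <-] [exG <-]; split.
  - intro c; exact (ex_derive_minus _ _ _ (exF c) (exG c)).
  - unfold total_D, pd.
    rewrite !Derive_minus by auto. ring.
Qed.

Lemma has_total_D_mult k F G j l m :
  has_total_D k F j l -> has_total_D k G j m ->
  has_total_D k (fun j => F j * G j) j (l * G j + F j * m).
Proof.
  intros [exF <-] [exG <-]; split.
  - intro c; exact (ex_derive_mult _ _ _ (exF c) (exG c)).
  - unfold total_D, pd.
    rewrite !Derive_mult by auto. rewrite !upd_self. ring.
Qed.

Lemma has_total_D_jet1 k i j :
  has_total_D k (fun j => j (jet1 i)) j (j (jet2 i k)).
Proof.
  split.
  - intro c; destruct c, i; cbn; auto_derive; exact I.
  - destruct k, i; unfold total_D, pd; cbn; rewrite ?Derive_const, ?Derive_id; ring.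
Qed.

Lemma has_total_D_lift k f j :
  has_partials f ->
  has_total_D k (lift f) j
    (lift (partial k f) j + j (jet1 k) * lift (pd_u f) j).
Proof.
  intro Hf; destruct (Hf (j c_t) (j c_x) (j c_y) (j c_u)) as (Ht & Hx & Hy & Hu).
  split.
  - intro c; destruct c; unfold lift; cbn;
      first [assumption | auto_derive; exact I].
  - destruct k; unfold total_D, pd, lift; cbn; rewrite ?Derive_const;
      unfold pd_t, pd_x, pd_y, pd_u; ring.
Qed.

Lemma smooth_partials f : smooth f -> has_partials f.
Proof. intro Hf; exact (proj1 (proj2 (Hf 1%nat))). Qed.

Lemma smooth_pd_u f : smooth f -> smooth (pd_u f).
Proof. intros Hf n; destruct (Hf (S n)) as (_ & _ & _ & _ & _ & H); exact H. Qed.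

Lemma smooth_partial i f : smooth f -> smooth (partial i f).
Proof.
  intros Hf n; destruct (Hf (S n)) as (_ & _ & Ht & Hx & Hy & _).
  destruct i; assumption.
Qed.

(** First and second total derivatives of a function of (t, x, y, u), expanded
    in partial derivatives. *)
Definition D1 (i : indep) (f : fn4) : jet -> R :=
  fun j => lift (partial i f) j + j (jet1 i) * lift (pd_u f) j.

Definition D2 (i k : indep) (f : fn4) : jet -> R :=
  fun j => D1 k (partial i f) j
           + (j (jet2 i k) * lift (pd_u f) j + j (jet1 i) * D1 k (pd_u f) j).

Lemma total_D_lift k f : has_partials f -> total_D k (lift f) = D1 k f.
Proof.
  intro Hf; apply functional_extensionality; intro j.
  exact (proj2 (has_total_D_lift k f j Hf)).
Qed.

Lemma has_total_D_D1 i k f j :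
  smooth f -> has_total_D k (D1 i f) j (D2 i k f j).
Proof.
  intro Hf.
  apply has_total_D_plus; [|apply has_total_D_mult].
  - apply has_total_D_lift, smooth_partials, smooth_partial, Hf.
  - apply has_total_D_jet1.
  - apply has_total_D_lift, smooth_partials, smooth_pd_u, Hf.
Qed.

Lemma phi1_eq V i :
  smooth_vfield V ->
  phi1 V i = fun j =>
    D1 i (phi V) j - j c_ut * D1 i (tau V) j
    - j c_ux * D1 i (xix V) j - j c_uy * D1 i (xiy V) j.
Proof.
  intros (Ht & Hx & Hy & Hp).
  unfold phi1; rewrite !total_D_lift by (apply smooth_partials; assumption).
  reflexivity.
Qed.

Lemma phi2_eq V i k j :
  smooth_vfield V ->
  phi2 V i k j =
    D2 i k (phi V) j
    - (j (jet2 i_t k) * D1 i (tau V) j + j c_ut * D2 i k (tau V) j)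
    - (j (jet2 i_x k) * D1 i (xix V) j + j c_ux * D2 i k (xix V) j)
    - (j (jet2 i_y k) * D1 i (xiy V) j + j c_uy * D2 i k (xiy V) j)
    - j (jet2 i i_t) * D1 k (tau V) j
    - j (jet2 i i_x) * D1 k (xix V) j
    - j (jet2 i i_y) * D1 k (xiy V) j.
Proof.
  intro HV; pose proof HV as (Ht & Hx & Hy & Hp).
  unfold phi2; rewrite phi1_eq by exact HV.
  rewrite !total_D_lift by (apply smooth_partials; assumption).
  do 3 f_equal.
  assert (H : forall i' f, smooth f ->
    has_total_D k (fun j => j (jet1 i') * D1 i f j) j
      (j (jet2 i' k) * D1 i f j + j (jet1 i') * D2 i k f j)).
  { intros i' f Hf; apply has_total_D_mult;
      [apply has_total_D_jet1 | apply has_total_D_D1, Hf]. }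
  refine (proj2 (_ : has_total_D _ _ _ _)).
  apply has_total_D_minus; [apply has_total_D_minus; [apply has_total_D_minus|]|].
  - apply has_total_D_D1, Hp.
  - exact (H i_t _ Ht).
  - exact (H i_x _ Hx).
  - exact (H i_y _ Hy).
Qed.

(** Differentiating M (x) N (y) multiplies it by p or q, so that xi and eta enter
    only through p xi + q eta. *)
Lemma pr2_FKDelta a b m1 n1 p q V j :
  pr2 V (FKDelta a b (fun x => m1 * exp (p * x)) (fun y => n1 * exp (q * y))) j =
  m1 * exp (p * j c_x) * (n1 * exp (q * j c_y)) *
    (p * lift (xix V) j + q * lift (xiy V) j) * j c_u ^ 2
  + lift (phi V) j *
    (2 * (m1 * exp (p * j c_x) * (n1 * exp (q * j c_y))) * j c_u - a)
  + phi1 V i_t j - b * (phi2 V i_x i_x j + phi2 V i_y i_y j).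
Proof.
  set (F := FKDelta _ _ _ _).
  assert (E : forall c d, is_derive (fun s => F (upd j c s)) (j c) d -> pd c F j = d)
    by (intros; apply is_derive_unique; assumption).
  unfold pr2.
  rewrite (E c_t 0), (E c_ut 1), (E c_ux 0), (E c_uy 0), (E c_uxx (- b)),
    (E c_uxy 0), (E c_uyy (- b)),
    (E c_x (p * (m1 * exp (p * j c_x) * (n1 * exp (q * j c_y))) * j c_u ^ 2)),
    (E c_y (q * (m1 * exp (p * j c_x) * (n1 * exp (q * j c_y))) * j c_u ^ 2)),
    (E c_u (2 * (m1 * exp (p * j c_x) * (n1 * exp (q * j c_y))) * j c_u - a));
    [ring| ..]; unfold F, FKDelta; cbn; auto_derive; trivial; ring.
Qed.

(** * Determining equations *)

(** The criterion is constant in u_tt, so that u_tt = 0 is no restriction. *)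
Definition jet_at (t x y u ut ux uy utx uty uxx uxy uyy : R) : jet :=
  fun c => match c with
  | c_t => t | c_x => x | c_y => y | c_u => u
  | c_ut => ut | c_ux => ux | c_uy => uy
  | c_utt => 0 | c_utx => utx | c_uty => uty
  | c_uxx => uxx | c_uxy => uxy | c_uyy => uyy
  end.

(** The equation can be solved for u_t, so the remaining jet coordinates may be
    chosen freely. *)
Lemma symmetry_at_solution_jet a b m1 n1 p q V t x y u ux uy utx uty uxx uxy uyy :
  symmetry_generator a b (fun x => m1 * exp (p * x)) (fun y => n1 * exp (q * y)) V ->
  let K := m1 * exp (p * x) * (n1 * exp (q * y)) in
  let j := jet_at t x y u (a * u - K * u ^ 2 + b * (uxx + uyy))
             ux uy utx uty uxx uxy uyy in
  K * (p * xix V t x y u + q * xiy V t x y u) * u ^ 2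
  + phi V t x y u * (2 * K * u - a)
  + phi1 V i_t j - b * (phi2 V i_x i_x j + phi2 V i_y i_y j) = 0.
Proof.
  intros [_ HV] K j.
  assert (Hj : FKDelta a b (fun x => m1 * exp (p * x)) (fun y => n1 * exp (q * y)) j = 0)
    by (unfold FKDelta, j, jet_at, K; ring).
  rewrite <- (HV j Hj), pr2_FKDelta. reflexivity.
Qed.

(** These are the coefficients of u_tx, u_ty and u_xy, each a polynomial in u_x
    and u_y.  They come first because they make many second derivatives vanish
    in the other coefficients. *)
Lemma second_order_conditions a b m1 n1 p q V :
  b <> 0 ->
  symmetry_generator a b (fun x => m1 * exp (p * x)) (fun y => n1 * exp (q * y)) V ->
  forall t x y u,
    (pd_x (tau V) t x y u = 0 /\ pd_y (tau V) t x y u = 0 /\ pd_u (tau V) t x y u = 0) /\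
    pd_u (xix V) t x y u = 0 /\ pd_u (xiy V) t x y u = 0 /\
    pd_y (xix V) t x y u + pd_x (xiy V) t x y u = 0.
Proof.
  intros hb HV t x y u.
  pose proof (fun ux uy utx uty uxy =>
    symmetry_at_solution_jet a b m1 n1 p q V t x y u ux uy utx uty 0 uxy 0 HV) as H.
  destruct HV as [HV _].
  cbv zeta in H.
  set (K := m1 * exp (p * x) * (n1 * exp (q * y))) in H.
  (* The difference of the criterion at two jets that agree except in u_tx, u_ty
     and u_xy isolates the terms containing these coordinates. *)
  assert (H' : forall ux uy utx uty uxy,
    b * (utx * (pd_x (tau V) t x y u + ux * pd_u (tau V) t x y u)
         + uty * (pd_y (tau V) t x y u + uy * pd_u (tau V) t x y u)
         + uxy * (pd_y (xix V) t x y u + pd_x (xiy V) t x y u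
                  + uy * pd_u (xix V) t x y u + ux * pd_u (xiy V) t x y u)) = 0).
  { intros ux uy utx uty uxy.
    pose proof (H ux uy utx uty uxy) as E1; pose proof (H ux uy 0 0 0) as E2.
    rewrite phi1_eq, !phi2_eq in E1, E2 by exact HV.
    cbv -[Rplus Rminus Rmult Ropp pow IZR tau xix xiy phi pd_t pd_x pd_y pd_u K] in E1, E2.
    lra. }
  assert (Hb : forall z, b * z = 0 -> z = 0)
    by (intros z Hz; apply Rmult_integral in Hz; tauto).
  pose proof (Hb _ (H' 0 0 1 0 0)); pose proof (Hb _ (H' 1 0 1 0 0)).
  pose proof (Hb _ (H' 0 0 0 1 0)); pose proof (Hb _ (H' 0 0 0 0 1)).
  pose proof (Hb _ (H' 1 0 0 0 1)); pose proof (Hb _ (H' 0 1 0 0 1)).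
  repeat split; lra.
Qed.

(** The null field is named so that a vanishing partial derivative is an equation
    between functions, along which higher derivatives can be rewritten. *)
Definition zero4 : fn4 := fun _ _ _ _ => 0.

Lemma fn4_ext (f g : fn4) : (forall t x y u, f t x y u = g t x y u) -> f = g.
Proof.
  intro H; do 4 (apply functional_extensionality; intro); apply H.
Qed.

Lemma affine_of_constant_Derive (f : R -> R) c :
  (forall s, ex_derive f s) -> (forall s, Derive f s = c) ->
  forall s, f s = f 0 + c * s.
Proof.
  intros exf Df s.
  destruct (MVT_gen f 0 s (fun _ => c)) as (z & _ & Hz).
  - intros r _; rewrite <- (Df r); apply Derive_correct, exf.
  - intros r _; apply derivable_continuous_pt, ex_derive_Reals_0, exf.
  - lra.
Qed.

Lemma partial_zero4 i : partial i zero4 = zero4.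
Proof.
  apply fn4_ext; intros; destruct i; exact (Derive_const 0 _).
Qed.

Lemma pd_u_zero4 : pd_u zero4 = zero4.
Proof. apply fn4_ext; intros; exact (Derive_const 0 _). Qed.

Lemma independent_of_u f :
  has_partials f -> pd_u f = zero4 -> forall t x y u, f t x y u = f t x y 0.
Proof.
  intros Hf Hu t x y u.
  rewrite (affine_of_constant_Derive (fun s => f t x y s) 0); [ring| |].
  - intro s; apply (Hf t x y s).
  - intro s; exact (f_equal (fun g : fn4 => g t x y s) Hu).
Qed.

Lemma pd_u_partial_zero i f :
  has_partials f -> pd_u f = zero4 -> pd_u (partial i f) = zero4.
Proof.
  intros Hf Hu; apply fn4_ext; intros t x y u.
  transitivity (Derive (fun _ => partial i f t x y 0) u); [|apply Derive_const].
  apply Derive_ext; intro s.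
  destruct i; apply Derive_ext; intro; apply independent_of_u; assumption.
Qed.

(** In order, these are the coefficients of u_xx, u_yy, u_x^2, u_x, u_y and 1.
    Both mixed derivatives of phi are kept, since nothing is known yet about
    their symmetry. *)
Lemma lower_order_conditions a b m1 n1 p q V :
  b <> 0 ->
  symmetry_generator a b (fun x => m1 * exp (p * x)) (fun y => n1 * exp (q * y)) V ->
  forall t x y u,
    pd_t (tau V) t x y u = 2 * pd_x (xix V) t x y u /\
    pd_t (tau V) t x y u = 2 * pd_y (xiy V) t x y u /\
    pd_u (pd_u (phi V)) t x y u = 0 /\
    pd_t (xix V) t x y u
      + b * (pd_x (pd_u (phi V)) t x y u + pd_u (pd_x (phi V)) t x y u)
      = b * (pd_x (pd_x (xix V)) t x y u + pd_y (pd_y (xix V)) t x y u) /\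
    pd_t (xiy V) t x y u
      + b * (pd_y (pd_u (phi V)) t x y u + pd_u (pd_y (phi V)) t x y u)
      = b * (pd_x (pd_x (xiy V)) t x y u + pd_y (pd_y (xiy V)) t x y u) /\
    (let K := m1 * exp (p * x) * (n1 * exp (q * y)) in
     K * (p * xix V t x y u + q * xiy V t x y u) * u ^ 2
     + phi V t x y u * (2 * K * u - a) + pd_t (phi V) t x y u
     + (pd_u (phi V) t x y u - pd_t (tau V) t x y u) * (a * u - K * u ^ 2)
     = b * (pd_x (pd_x (phi V)) t x y u + pd_y (pd_y (phi V)) t x y u)).
Proof.
  intros hb HV t x y u.
  pose proof (second_order_conditions a b m1 n1 p q V hb HV) as H2.
  pose proof (fun ux uy uxx uyy =>
    symmetry_at_solution_jet a b m1 n1 p q V t x y u ux uy 0 0 uxx 0 uyy HV) as H.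
  destruct HV as [HV _]; pose proof HV as (_ & Sx & Sy & _).
  assert (Ttx : pd_x (tau V) = zero4) by (apply fn4_ext; apply H2).
  assert (Tty : pd_y (tau V) = zero4) by (apply fn4_ext; apply H2).
  assert (Ttu : pd_u (tau V) = zero4) by (apply fn4_ext; apply H2).
  assert (Txu : pd_u (xix V) = zero4) by (apply fn4_ext; apply H2).
  assert (Tyu : pd_u (xiy V) = zero4) by (apply fn4_ext; apply H2).
  pose proof (proj2 (proj2 (proj2 (H2 t x y u)))) as Txy.
  pose proof (fun i => pd_u_partial_zero i _ (smooth_partials _ Sx) Txu) as Txiu.
  pose proof (fun i => pd_u_partial_zero i _ (smooth_partials _ Sy) Tyu) as Tyiu.
  cbv zeta in *.
  set (K := m1 * exp (p * x) * (n1 * exp (q * y))) in *.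
  (* The criterion, with its terms collected by powers of the jet coordinates. *)
  assert (H' : forall ux uy uxx uyy,
    b * (uxx * (2 * pd_x (xix V) t x y u - pd_t (tau V) t x y u)
         + uyy * (2 * pd_y (xiy V) t x y u - pd_t (tau V) t x y u)
         - (ux ^ 2 + uy ^ 2) * pd_u (pd_u (phi V)) t x y u)
    - ux * (pd_t (xix V) t x y u
            + b * (pd_x (pd_u (phi V)) t x y u + pd_u (pd_x (phi V)) t x y u)
            - b * (pd_x (pd_x (xix V)) t x y u + pd_y (pd_y (xix V)) t x y u))
    - uy * (pd_t (xiy V) t x y u
            + b * (pd_y (pd_u (phi V)) t x y u + pd_u (pd_y (phi V)) t x y u)
            - b * (pd_x (pd_x (xiy V)) t x y u + pd_y (pd_y (xiy V)) t x y u))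
    + (K * (p * xix V t x y u + q * xiy V t x y u) * u ^ 2
       + phi V t x y u * (2 * K * u - a) + pd_t (phi V) t x y u
       + (pd_u (phi V) t x y u - pd_t (tau V) t x y u) * (a * u - K * u ^ 2)
       - b * (pd_x (pd_x (phi V)) t x y u + pd_y (pd_y (phi V)) t x y u)) = 0).
  { intros ux uy uxx uyy.
    pose proof (H ux uy uxx uyy) as E.
    rewrite phi1_eq, !phi2_eq in E by exact HV.
    unfold D2, D1 in E; cbn [partial base jet1 jet2] in E.
    pose proof (Txiu i_x) as T1; pose proof (Txiu i_y) as T2;
      pose proof (Tyiu i_x) as T3; pose proof (Tyiu i_y) as T4.
    pose proof (partial_zero4 i_x) as Z1; pose proof (partial_zero4 i_y) as Z2.
    cbn [partial] in T1, T2, T3, T4, Z1, Z2.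
    rewrite ?T1, ?T2, ?T3, ?T4, ?Ttx, ?Tty, ?Ttu, ?Txu, ?Tyu, ?Z1, ?Z2, ?pd_u_zero4 in E.
    cbv -[Rplus Rminus Rmult Ropp pow IZR tau xix xiy phi pd_t pd_x pd_y pd_u K] in E.
    lra. }
  assert (Hb : forall z, b * z = 0 -> z = 0)
    by (intros z Hz; apply Rmult_integral in Hz; tauto).
  pose proof (H' 0 0 0 0) as E0.
  pose proof (H' 1 0 0 0) as E1; pose proof (H' (-1) 0 0 0) as E2.
  pose proof (H' 0 1 0 0) as E3; pose proof (H' 0 (-1) 0 0) as E4.
  pose proof (H' 0 0 1 0) as E5; pose proof (H' 0 0 0 1) as E6.
  assert (2 * pd_x (xix V) t x y u - pd_t (tau V) t x y u = 0) by (apply Hb; lra).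
  assert (2 * pd_y (xiy V) t x y u - pd_t (tau V) t x y u = 0) by (apply Hb; lra).
  assert (pd_u (pd_u (phi V)) t x y u = 0) by (apply Hb; lra).
  repeat split; lra.
Qed.

(** * Solving the determining equations *)

Lemma independent_of_x f :
  has_partials f -> pd_x f = zero4 -> forall t x y u, f t x y u = f t 0 y u.
Proof.
  intros Hf Hx t x y u.
  rewrite (affine_of_constant_Derive (fun s => f t s y u) 0); [ring| |].
  - intro s; apply (Hf t s y u).
  - intro s; exact (f_equal (fun g : fn4 => g t s y u) Hx).
Qed.

Lemma independent_of_y f :
  has_partials f -> pd_y f = zero4 -> forall t x y u, f t x y u = f t x 0 u.
Proof.
  intros Hf Hy t x y u.
  rewrite (affine_of_constant_Derive (fun s => f t x s u) 0); [ring| |].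
  - intro s; apply (Hf t x s u).
  - intro s; exact (f_equal (fun g : fn4 => g t x s u) Hy).
Qed.

(** The functions f (t, 0, y) and g (t, x, 0) are what the diagonal equations
    leave free; the off-diagonal one equates a function of (t, y) with one of
    (t, x), so that both are affine with opposite slopes. *)
Lemma conformal_field_form f g (h : R -> R) :
  has_partials f -> has_partials g ->
  pd_u f = zero4 -> pd_u g = zero4 ->
  (forall t x y u, pd_x f t x y u = h t) ->
  (forall t x y u, pd_y g t x y u = h t) ->
  (forall t x y u, pd_y f t x y u + pd_x g t x y u = 0) ->
  forall t x y u,
    f t x y u = f t 0 0 0 + h t * x - pd_x g t 0 0 0 * y /\
    g t x y u = g t 0 0 0 + h t * y + pd_x g t 0 0 0 * x /\
    pd_x g t x y u = pd_x g t 0 0 0.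
Proof.
  intros Hf Hg Hfu Hgu Hfx Hgy Hfg t.
  assert (f0 : forall x y u, f t x y u = f t 0 y 0 + h t * x).
  { intros x y u; rewrite (independent_of_u f Hf Hfu).
    apply (affine_of_constant_Derive (fun s => f t s y 0)); intro s;
      [apply (Hf t s y 0) | apply Hfx]. }
  assert (g0 : forall x y u, g t x y u = g t x 0 0 + h t * y).
  { intros x y u; rewrite (independent_of_u g Hg Hgu).
    apply (affine_of_constant_Derive (fun s => g t x s 0)); intro s;
      [apply (Hg t x s 0) | apply Hgy]. }
  assert (gx : forall x y u, pd_x g t x y u = pd_x g t x 0 0).
  { intros x y u.
    transitivity (Derive (fun s => g t s 0 0 + h t * y) x);
      [apply Derive_ext; intro s; apply g0|].
    rewrite Derive_plus, Derive_const;
      [unfold pd_x; ring | apply (Hg t x 0 0) | apply ex_derive_const]. }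
  assert (fy : forall x y u, pd_y f t x y u = pd_y f t 0 y 0).
  { intros x y u.
    transitivity (Derive (fun s => f t 0 s 0 + h t * x) y);
      [apply Derive_ext; intro s; apply f0|].
    rewrite Derive_plus, Derive_const;
      [unfold pd_y; ring | apply (Hf t 0 y 0) | apply ex_derive_const]. }
  (* In f_y = - g_x the left side depends only on (t, y) and the right side only
     on (t, x). *)
  assert (fy' : forall y, pd_y f t 0 y 0 = - pd_x g t 0 0 0).
  { intro y; pose proof (Hfg t 0 y 0) as E; rewrite gx in E; lra. }
  assert (gx' : forall x, pd_x g t x 0 0 = pd_x g t 0 0 0).
  { intro x; pose proof (Hfg t x 0 0) as E; rewrite fy, fy' in E; lra. }
  intros x y u; split; [|split].
  - rewrite f0.
    rewrite (affine_of_constant_Derive (fun s => f t 0 s 0) _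
               (fun s => proj1 (proj2 (proj2 (Hf t 0 s 0)))) fy'). ring.
  - rewrite g0.
    rewrite (affine_of_constant_Derive (fun s => g t s 0 0) _
               (fun s => proj1 (proj2 (Hg t s 0 0))) gx'). ring.
  - rewrite gx; apply gx'.
Qed.

(** Affinity is stated by interpolation between u = 0 and u = 1 because this form
    involves no derivative in u, and so passes directly to the derivatives in
    t, x and y. *)
Definition affine_in_u (f : fn4) : Prop :=
  forall t x y u, f t x y u = (1 - u) * f t x y 0 + u * f t x y 1.

Lemma affine_in_u_of_pd_uu f :
  smooth f -> pd_u (pd_u f) = zero4 -> affine_in_u f.
Proof.
  intros Hf Huu t x y.
  assert (H : forall u, f t x y u = f t x y 0 + pd_u f t x y 0 * u).
  { apply (affine_of_constant_Derive (fun s => f t x y s)); intro s.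
    - apply (smooth_partials f Hf t x y s).
    - apply (independent_of_u (pd_u f)); [|exact Huu].
      apply smooth_partials, smooth_pd_u, Hf. }
  intro u; rewrite (H u), (H 1); ring.
Qed.

Lemma affine_in_u_partial i f :
  has_partials f -> affine_in_u f -> affine_in_u (partial i f).
Proof.
  intros Hf Ha t x y u.
  destruct (Hf t x y 0) as (Ht0 & Hx0 & Hy0 & _), (Hf t x y 1) as (Ht1 & Hx1 & Hy1 & _).
  destruct i; cbn [partial].
  - transitivity (Derive (fun s => (1 - u) * f s x y 0 + u * f s x y 1) t);
      [apply Derive_ext; intro; apply Ha|].
    rewrite Derive_plus, !Derive_scal; [reflexivity| |];
      apply ex_derive_scal; assumption.
  - transitivity (Derive (fun s => (1 - u) * f t s y 0 + u * f t s y 1) x);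
      [apply Derive_ext; intro; apply Ha|].
    rewrite Derive_plus, !Derive_scal; [reflexivity| |];
      apply ex_derive_scal; assumption.
  - transitivity (Derive (fun s => (1 - u) * f t x s 0 + u * f t x s 1) y);
      [apply Derive_ext; intro; apply Ha|].
    rewrite Derive_plus, !Derive_scal; [reflexivity| |];
      apply ex_derive_scal; assumption.
Qed.

Lemma pd_u_affine f t x y u :
  affine_in_u f -> pd_u f t x y u = f t x y 1 - f t x y 0.
Proof.
  intro Ha.
  transitivity (Derive (fun s => (1 - s) * f t x y 0 + s * f t x y 1) u);
    [apply Derive_ext; intro; apply Ha|].
  apply is_derive_unique; auto_derive; [trivial | ring].
Qed.

(** Both sides are the difference of the values of a first derivative of f at
    u = 1 and u = 0. *)
Lemma pd_u_partial_affine i f :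
  has_partials f -> affine_in_u f -> pd_u (partial i f) = partial i (pd_u f).
Proof.
  intros Hf Ha; apply fn4_ext; intros t x y u.
  rewrite pd_u_affine by (apply affine_in_u_partial; assumption).
  destruct (Hf t x y 0) as (Ht0 & Hx0 & Hy0 & _), (Hf t x y 1) as (Ht1 & Hx1 & Hy1 & _).
  destruct i; cbn [partial]; symmetry.
  - transitivity (Derive (fun s => f s x y 1 - f s x y 0) t);
      [apply Derive_ext; intro; apply pd_u_affine, Ha|].
    apply Derive_minus; assumption.
  - transitivity (Derive (fun s => f t s y 1 - f t s y 0) x);
      [apply Derive_ext; intro; apply pd_u_affine, Ha|].
    apply Derive_minus; assumption.
  - transitivity (Derive (fun s => f t x s 1 - f t x s 0) y);
      [apply Derive_ext; intro; apply pd_u_affine, Ha|].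
    apply Derive_minus; assumption.
Qed.

(** Here [t0], [al], [be], [r] and [t1] are the coefficients of the translations
    in t, x and y, of the rotation and of the scaling. *)
Definition FK_field (b p q t0 t1 r al be : R) : vfield :=
  let xi t x y := t1 / 2 * x - r * y + b * (p * t1 + 2 * q * r) * t + al in
  let eta t x y := t1 / 2 * y + r * x + b * (q * t1 - 2 * p * r) * t + be in
  VField (fun t _ _ _ => t0 + t1 * t)
         (fun t x y _ => xi t x y)
         (fun t x y _ => eta t x y)
         (fun t x y u => - (p * xi t x y + q * eta t x y + t1) * u).

(** The part of the criterion free of derivatives of u is quadratic in u, as phi
    is affine; its three coefficients are read off at u = 0, 1, -1.  In the
    leading one the factor M (x) N (y) cancels. *)
Lemma coefficients_in_u a b m1 n1 p q V :
  b <> 0 -> m1 <> 0 -> n1 <> 0 ->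
  symmetry_generator a b (fun x => m1 * exp (p * x)) (fun y => n1 * exp (q * y)) V ->
  affine_in_u (phi V) /\
  forall t x y,
    pd_u (phi V) t x y 0 =
      - (p * xix V t x y 0 + q * xiy V t x y 0 + pd_t (tau V) t x y 0) /\
    2 * (m1 * exp (p * x) * (n1 * exp (q * y))) * phi V t x y 0
      + pd_u (pd_t (phi V)) t x y 0 - a * pd_t (tau V) t x y 0
      = b * (pd_u (pd_x (pd_x (phi V))) t x y 0 + pd_u (pd_y (pd_y (phi V))) t x y 0) /\
    pd_t (phi V) t x y 0 - a * phi V t x y 0
      = b * (pd_x (pd_x (phi V)) t x y 0 + pd_y (pd_y (phi V)) t x y 0).
Proof.
  intros hb hm hn HV.
  pose proof (second_order_conditions a b m1 n1 p q V hb HV) as H2.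
  pose proof (lower_order_conditions a b m1 n1 p q V hb HV) as H1.
  destruct HV as [(St & Sx & Sy & Sp) _].
  assert (Ha : affine_in_u (phi V))
    by (apply affine_in_u_of_pd_uu; [exact Sp|]; apply fn4_ext; apply H1).
  split; [exact Ha|]; intros t x y.
  assert (Aff : forall i f, smooth f -> affine_in_u f -> affine_in_u (partial i f))
    by (intros i f Hf; apply affine_in_u_partial, smooth_partials, Hf).
  pose proof (Aff i_t _ Sp Ha) as At.
  pose proof (Aff i_x _ (smooth_partial i_x _ Sp) (Aff i_x _ Sp Ha)) as Axx.
  pose proof (Aff i_y _ (smooth_partial i_y _ Sp) (Aff i_y _ Sp Ha)) as Ayy.
  cbn [partial] in At, Axx, Ayy.
  pose proof (fun u => independent_of_u _ (smooth_partials _ Sx)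
    (fn4_ext _ zero4 (fun t x y u => proj1 (proj2 (H2 t x y u)))) t x y u) as xi0.
  pose proof (fun u => independent_of_u _ (smooth_partials _ Sy)
    (fn4_ext _ zero4 (fun t x y u => proj1 (proj2 (proj2 (H2 t x y u))))) t x y u) as eta0.
  assert (taut0 : forall u, pd_t (tau V) t x y u = pd_t (tau V) t x y 0).
  { intro u; apply Derive_ext; intro s; apply independent_of_u;
      [apply smooth_partials, St | apply fn4_ext; apply H2]. }
  assert (Bal : forall u, let K := m1 * exp (p * x) * (n1 * exp (q * y)) in
    K * (p * xix V t x y 0 + q * xiy V t x y 0) * u ^ 2
    + ((1 - u) * phi V t x y 0 + u * phi V t x y 1) * (2 * K * u - a)
    + ((1 - u) * pd_t (phi V) t x y 0 + u * pd_t (phi V) t x y 1)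
    + (phi V t x y 1 - phi V t x y 0 - pd_t (tau V) t x y 0) * (a * u - K * u ^ 2)
    = b * ((1 - u) * pd_x (pd_x (phi V)) t x y 0 + u * pd_x (pd_x (phi V)) t x y 1
           + ((1 - u) * pd_y (pd_y (phi V)) t x y 0 + u * pd_y (pd_y (phi V)) t x y 1))).
  { intros u K.
    destruct (H1 t x y u) as (_ & _ & _ & _ & _ & E); cbv zeta in E; fold K in E.
    rewrite xi0, eta0, taut0, pd_u_affine, (Ha t x y u), (At t x y u),
      (Axx t x y u), (Ayy t x y u) in E by exact Ha.
    exact E. }
  rewrite !pd_u_affine by assumption.
  cbv zeta in Bal.
  set (K := m1 * exp (p * x) * (n1 * exp (q * y))) in *.
  assert (hK : K <> 0).
  { unfold K; repeat apply Rmult_integral_contrapositive_currified;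
      try assumption; apply Rgt_not_eq, exp_pos. }
  pose proof (Bal 0) as B0; pose proof (Bal 1) as B1; pose proof (Bal (-1)) as B2.
  assert (E2 : K * (p * xix V t x y 0 + q * xiy V t x y 0
                    + (phi V t x y 1 - phi V t x y 0) + pd_t (tau V) t x y 0) = 0) by lra.
  apply Rmult_integral in E2; destruct E2 as [E2|E2]; [contradiction|].
  repeat split; try lra.
Qed.

(** With phi_u = - (p xi + q eta + tau'), the coefficient of u_x becomes
    xi_t = - 2 b phi_ux = 2 b (p h + q r), where h = tau' / 2 and r = eta_x, and
    similarly for eta.  The right side depends on t only, whereas xi_t contains
    h' x - r' y: hence h and r are constants, and all coefficients are affine. *)
Lemma coefficients_of_symmetry a b m1 n1 p q V :
  b <> 0 -> m1 <> 0 -> n1 <> 0 ->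
  symmetry_generator a b (fun x => m1 * exp (p * x)) (fun y => n1 * exp (q * y)) V ->
  exists t0 t1 r al be,
    let W := FK_field b p q t0 t1 r al be in
    tau V = tau W /\ xix V = xix W /\ xiy V = xiy W /\ pd_u (phi V) = pd_u (phi W).
Proof.
  intros hb hm hn HV.
  pose proof (second_order_conditions a b m1 n1 p q V hb HV) as H2.
  pose proof (lower_order_conditions a b m1 n1 p q V hb HV) as H1.
  destruct (coefficients_in_u a b m1 n1 p q V hb hm hn HV) as [Ha Hc].
  destruct HV as [(St & Sx & Sy & Sp) _].
  pose proof (smooth_partials _ St) as Pt; pose proof (smooth_partials _ Sx) as Px;
    pose proof (smooth_partials _ Sy) as Py; pose proof (smooth_partials _ Sp) as Pp.
  assert (tau0 : forall t x y u, tau V t x y u = tau V t 0 0 0).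
  { intros t x y u.
    rewrite (independent_of_u (tau V)), (independent_of_y (tau V)),
      (independent_of_x (tau V)); trivial; apply fn4_ext; apply H2. }
  set (h := fun t => pd_t (tau V) t 0 0 0 / 2).
  assert (tau_t : forall t x y u, pd_t (tau V) t x y u = 2 * h t).
  { intros t x y u; unfold h.
    replace (2 * (_ / 2)) with (pd_t (tau V) t 0 0 0) by field.
    apply Derive_ext; intro s; apply tau0. }
  assert (xi_x : forall t x y u, pd_x (xix V) t x y u = h t).
  { intros t x y u; pose proof (proj1 (H1 t x y u)) as E; rewrite tau_t in E; lra. }
  assert (eta_y : forall t x y u, pd_y (xiy V) t x y u = h t).
  { intros t x y u; pose proof (proj1 (proj2 (H1 t x y u))) as E; rewrite tau_t in E; lra. }
  set (r := fun t => pd_x (xiy V) t 0 0 0).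
  assert (Form : forall t x y u,
    xix V t x y u = xix V t 0 0 0 + h t * x - r t * y /\
    xiy V t x y u = xiy V t 0 0 0 + h t * y + r t * x /\
    pd_x (xiy V) t x y u = r t).
  { intros t x y u; unfold r; revert t x y u. apply conformal_field_form; trivial;
      try (apply fn4_ext; apply H2). intros; apply H2. }
  assert (xi_y : forall t x y u, pd_y (xix V) t x y u = - r t).
  { intros t x y u; pose proof (proj2 (proj2 (proj2 (H2 t x y u)))) as E.
    rewrite (proj2 (proj2 (Form t x y u))) in E; lra. }
  assert (phi_u : forall t x y u,
    pd_u (phi V) t x y u = - (p * xix V t x y 0 + q * xiy V t x y 0 + 2 * h t)).
  { intros t x y u; rewrite <- (tau_t t x y 0), <- (proj1 (Hc t x y)).
    rewrite !pd_u_affine by exact Ha; reflexivity. }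
  assert (phi_ux : forall t x y u,
    pd_x (pd_u (phi V)) t x y u = - (p * h t + q * r t)).
  { intros t x y u.
    transitivity (Derive (fun s =>
      - (p * (xix V t 0 0 0 + h t * s - r t * y)
         + q * (xiy V t 0 0 0 + h t * y + r t * s) + 2 * h t)) x).
    - apply Derive_ext; intro s; rewrite phi_u.
      rewrite (proj1 (Form t s y 0)), (proj1 (proj2 (Form t s y 0))); reflexivity.
    - apply is_derive_unique; auto_derive; [trivial | ring]. }
  assert (phi_uy : forall t x y u,
    pd_y (pd_u (phi V)) t x y u = - (q * h t - p * r t)).
  { intros t x y u.
    transitivity (Derive (fun s =>
      - (p * (xix V t 0 0 0 + h t * x - r t * s)
         + q * (xiy V t 0 0 0 + h t * s + r t * x) + 2 * h t)) y).
    - apply Derive_ext; intro s; rewrite phi_u.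
      rewrite (proj1 (Form t x s 0)), (proj1 (proj2 (Form t x s 0))); reflexivity.
    - apply is_derive_unique; auto_derive; [trivial | ring]. }
  assert (Const : forall (F : R -> R) (c z : R), (forall s, F s = c) -> Derive F z = 0).
  { intros F c z HF; rewrite (Derive_ext F (fun _ => c)) by exact HF.
    apply Derive_const. }
  assert (xi_t : forall t x y u, pd_t (xix V) t x y u = 2 * b * (p * h t + q * r t)).
  { intros t x y u; destruct (H1 t x y u) as (_ & _ & _ & E & _).
    rewrite (pd_u_partial_affine i_x) in E by assumption; cbn [partial] in E.
    assert (Zx : pd_x (pd_x (xix V)) t x y u = 0)
      by (apply (Const _ (h t)); intro; apply xi_x).
    assert (Zy : pd_y (pd_y (xix V)) t x y u = 0)
      by (apply (Const _ (- r t)); intro; apply xi_y).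
    rewrite phi_ux, Zx, Zy in E; lra. }
  assert (eta_t : forall t x y u, pd_t (xiy V) t x y u = 2 * b * (q * h t - p * r t)).
  { intros t x y u; destruct (H1 t x y u) as (_ & _ & _ & _ & E & _).
    rewrite (pd_u_partial_affine i_y) in E by assumption; cbn [partial] in E.
    assert (Zx : pd_x (pd_x (xiy V)) t x y u = 0)
      by (apply (Const _ (r t)); intro; apply Form).
    assert (Zy : pd_y (pd_y (xiy V)) t x y u = 0)
      by (apply (Const _ (h t)); intro; apply eta_y).
    rewrite phi_uy, Zx, Zy in E; lra. }
  (* The derivatives xi_t at different points (x, y) agree, so xi - xi (t, 0, 0)
     does not depend on t; at (1, 0) and (0, 1) it equals h and - r. *)
  assert (Diff : forall x y t,
    xix V t x y 0 - xix V t 0 0 0 = xix V 0 x y 0 - xix V 0 0 0 0).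
  { intros x y t.
    rewrite (affine_of_constant_Derive
               (fun s => xix V s x y 0 - xix V s 0 0 0) 0); [ring| |]; intro s.
    - exact (ex_derive_minus (fun s => xix V s x y 0) (fun s => xix V s 0 0 0) s
               (proj1 (Px s x y 0)) (proj1 (Px s 0 0 0))).
    - rewrite Derive_minus; [|apply (proj1 (Px s x y 0))|apply (proj1 (Px s 0 0 0))].
      change (pd_t (xix V) s x y 0 - pd_t (xix V) s 0 0 0 = 0).
      rewrite !xi_t; ring. }
  assert (h0 : forall t, h t = h 0).
  { intro t; pose proof (Diff 1 0 t) as E.
    rewrite (proj1 (Form t 1 0 0)), (proj1 (Form 0 1 0 0)) in E; lra. }
  assert (r0 : forall t, r t = r 0).
  { intro t; pose proof (Diff 0 1 t) as E.
    rewrite (proj1 (Form t 0 1 0)), (proj1 (Form 0 0 1 0)) in E; lra. }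
  assert (al : forall t, xix V t 0 0 0 = xix V 0 0 0 0 + 2 * b * (p * h 0 + q * r 0) * t).
  { apply (affine_of_constant_Derive (fun s => xix V s 0 0 0)); intro s;
      [apply (proj1 (Px s 0 0 0))|].
    rewrite <- (h0 s), <- (r0 s); apply xi_t. }
  assert (be : forall t, xiy V t 0 0 0 = xiy V 0 0 0 0 + 2 * b * (q * h 0 - p * r 0) * t).
  { apply (affine_of_constant_Derive (fun s => xiy V s 0 0 0)); intro s;
      [apply (proj1 (Py s 0 0 0))|].
    rewrite <- (h0 s), <- (r0 s); apply eta_t. }
  assert (ta : forall t, tau V t 0 0 0 = tau V 0 0 0 0 + 2 * h 0 * t).
  { apply (affine_of_constant_Derive (fun s => tau V s 0 0 0)); intro s;
      [apply (proj1 (Pt s 0 0 0))|].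
    rewrite <- (h0 s); apply tau_t. }
  exists (tau V 0 0 0 0), (2 * h 0), (r 0), (xix V 0 0 0 0), (xiy V 0 0 0 0).
  cbv zeta; repeat split; apply fn4_ext; intros t x y u; cbn [FK_field tau xix xiy phi].
  - rewrite tau0; apply ta.
  - rewrite (proj1 (Form t x y u)), al, (h0 t), (r0 t); field.
  - rewrite (proj1 (proj2 (Form t x y u))), be, (h0 t), (r0 t); field.
  - rewrite phi_u, (proj1 (Form t x y 0)), (proj1 (proj2 (Form t x y 0))), al, be, (h0 t), (r0 t).
    symmetry; apply is_derive_unique; auto_derive; [trivial | field].
Qed.

(** The coefficient of u gives 2 M N phi = k t1 at u = 0, hence
    phi = C exp (- (p x + q y)) there.  The coefficient of 1 then reads
    - a phi = b (p^2 + q^2) phi, that is k C = 0, so that k^2 t1 = 0. *)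
Lemma symmetry_normal_form a b m1 n1 p q V :
  b <> 0 -> m1 <> 0 -> n1 <> 0 ->
  symmetry_generator a b (fun x => m1 * exp (p * x)) (fun y => n1 * exp (q * y)) V ->
  exists t0 t1 r al be,
    (a + b * (p ^ 2 + q ^ 2)) * t1 = 0 /\ V = FK_field b p q t0 t1 r al be.
Proof.
  intros hb hm hn HV.
  destruct (coefficients_in_u a b m1 n1 p q V hb hm hn HV) as [Ha Hc].
  destruct (coefficients_of_symmetry a b m1 n1 p q V hb hm hn HV)
    as (t0 & t1 & r & al & be & Et & Ex & Ey & Eu).
  exists t0, t1, r, al, be.
  set (W := FK_field b p q t0 t1 r al be) in *.
  destruct HV as [(_ & _ & _ & Sp) _].
  assert (tau_t : forall t x y, pd_t (tau V) t x y 0 = t1).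
  { intros t x y; rewrite Et; apply is_derive_unique; cbn; auto_derive; [trivial | ring]. }
  set (c := fun t x y => - (p * (t1 / 2 * x - r * y + b * (p * t1 + 2 * q * r) * t + al)
    + q * (t1 / 2 * y + r * x + b * (q * t1 - 2 * p * r) * t + be) + t1)).
  assert (phi_u : pd_u (phi V) = fun t x y _ => c t x y).
  { rewrite Eu; apply fn4_ext; intros; apply is_derive_unique; unfold c; cbn; auto_derive;
      [trivial | ring]. }
  assert (phi_ut : pd_u (pd_t (phi V)) = fun _ _ _ _ => - (b * (p ^ 2 + q ^ 2) * t1)).
  { rewrite (pd_u_partial_affine i_t), phi_u by (try apply smooth_partials; assumption).
    apply fn4_ext; intros; apply is_derive_unique; unfold c; auto_derive;
      [trivial | ring]. }
  assert (phi_ux : pd_u (pd_x (phi V)) = fun _ _ _ _ => - (p * t1 / 2 + q * r)).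
  { rewrite (pd_u_partial_affine i_x), phi_u by (try apply smooth_partials; assumption).
    apply fn4_ext; intros; apply is_derive_unique; unfold c; auto_derive;
      [trivial | field]. }
  assert (phi_uy : pd_u (pd_y (phi V)) = fun _ _ _ _ => - (q * t1 / 2 - p * r)).
  { rewrite (pd_u_partial_affine i_y), phi_u by (try apply smooth_partials; assumption).
    apply fn4_ext; intros; apply is_derive_unique; unfold c; auto_derive;
      [trivial | field]. }
  assert (phi_uxx : forall t x y, pd_u (pd_x (pd_x (phi V))) t x y 0 = 0).
  { intros t x y.
    pose proof (smooth_partial i_x _ Sp) as Sx.
    pose proof (pd_u_partial_affine i_x _ (smooth_partials _ Sx)
      (affine_in_u_partial i_x _ (smooth_partials _ Sp) Ha)) as E.
    cbn [partial] in E; rewrite E, phi_ux.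
    exact (Derive_const _ _). }
  assert (phi_uyy : forall t x y, pd_u (pd_y (pd_y (phi V))) t x y 0 = 0).
  { intros t x y.
    pose proof (smooth_partial i_y _ Sp) as Sy.
    pose proof (pd_u_partial_affine i_y _ (smooth_partials _ Sy)
      (affine_in_u_partial i_y _ (smooth_partials _ Sp) Ha)) as E.
    cbn [partial] in E; rewrite E, phi_uy.
    exact (Derive_const _ _). }
  set (k := a + b * (p ^ 2 + q ^ 2)).
  set (C := k * t1 / (2 * (m1 * n1))).
  assert (phi0 : forall t x y, phi V t x y 0 = C * exp (- (p * x)) * exp (- (q * y))).
  { intros t x y; destruct (Hc t x y) as (_ & E & _).
    rewrite phi_ut, phi_uxx, phi_uyy, tau_t in E.
    assert (E' : 2 * (m1 * exp (p * x) * (n1 * exp (q * y))) * phi V t x y 0 = k * t1)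
      by (unfold k; lra).
    unfold C; rewrite <- E', !exp_Ropp; field.
    repeat split; try assumption; apply Rgt_not_eq, exp_pos. }
  assert (phi0_t : forall t x y, pd_t (phi V) t x y 0 = 0).
  { intros t x y; unfold pd_t.
    rewrite (Derive_ext _ _ _ (fun s => phi0 s x y)); apply Derive_const. }
  assert (phi0_xx : forall t x y,
    pd_x (pd_x (phi V)) t x y 0 = p ^ 2 * phi V t x y 0).
  { intros t x y.
    transitivity (Derive (fun s => - p * C * exp (- (p * s)) * exp (- (q * y))) x).
    - apply Derive_ext; intro s; unfold pd_x.
      rewrite (Derive_ext _ _ _ (fun s => phi0 t s y)).
      apply is_derive_unique; auto_derive; [trivial | ring].
    - rewrite phi0; apply is_derive_unique; auto_derive; [trivial | ring]. }
  assert (phi0_yy : forall t x y,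
    pd_y (pd_y (phi V)) t x y 0 = q ^ 2 * phi V t x y 0).
  { intros t x y.
    transitivity (Derive (fun s => - q * C * exp (- (p * x)) * exp (- (q * s))) y).
    - apply Derive_ext; intro s; unfold pd_y.
      rewrite (Derive_ext _ _ _ (fun s => phi0 t x s)).
      apply is_derive_unique; auto_derive; [trivial | ring].
    - rewrite phi0; apply is_derive_unique; auto_derive; [trivial | ring]. }
  assert (kC : k * C = 0).
  { destruct (Hc 0 0 0) as (_ & _ & E).
    rewrite phi0_t, phi0_xx, phi0_yy, phi0 in E.
    rewrite !Rmult_0_r, Ropp_0, exp_0 in E; unfold k; lra. }
  assert (kt : k * t1 = 0).
  { assert (k * (k * t1) = 0).
    { transitivity (2 * (m1 * n1) * (k * C)); [unfold C; field; tauto | rewrite kC; ring]. }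
    destruct (Rmult_integral k (k * t1)) as [Hk|Hk]; trivial. rewrite Hk; ring. }
  split; [exact kt|].
  assert (Ep : phi V = phi W).
  { apply fn4_ext; intros t x y u.
    rewrite (affine_of_constant_Derive (fun s => phi V t x y s) (c t x y)).
    - rewrite phi0; unfold C; rewrite kt; cbn; unfold c, Rdiv; ring.
    - intro s; apply (smooth_partials _ Sp t x y s).
    - intro s; exact (f_equal (fun g : fn4 => g t x y s) phi_u). }
  destruct V; cbn in Et, Ex, Ey, Ep; rewrite Et, Ex, Ey, Ep; reflexivity.
Qed.

(** * Smoothness of polynomial functions *)

Lemma Ck_of_Ck_S n f : Ck (S n) f -> Ck n f.
Proof.
  revert f; induction n as [|n IH]; intros f [Hc (Hp & Ht & Hx & Hy & Hu)].
  - split; [exact Hc | exact I].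
  - exact (conj Hc (conj Hp (conj (IH _ Ht) (conj (IH _ Hx) (conj (IH _ Hy) (IH _ Hu)))))).
Qed.

Lemma smooth_of_partials f :
  jointly_continuous f -> has_partials f ->
  smooth (pd_t f) -> smooth (pd_x f) -> smooth (pd_y f) -> smooth (pd_u f) -> smooth f.
Proof.
  intros Hc Hp Ht Hx Hy Hu [|n].
  - exact (conj Hc I).
  - exact (conj Hc (conj Hp (conj (Ht n) (conj (Hx n) (conj (Hy n) (Hu n)))))).
Qed.

Lemma jointly_continuous_of_continuous f (F : R * R * R * R -> R) :
  (forall t x y u, F (t, x, y, u) = f t x y u) ->
  (forall z, continuous F z) -> jointly_continuous f.
Proof.
  intros HF Hc z; apply (continuous_ext F); [|apply Hc].
  intros [[[t x] y] u]; apply HF.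
Qed.

Lemma smooth_const c : smooth (fun _ _ _ _ => c).
Proof.
  intro n; revert c; induction n as [|n IH]; intro c;
    assert (Hc : jointly_continuous (fun _ _ _ _ => c))
      by (apply (jointly_continuous_of_continuous _ (fun _ => c));
          [reflexivity | intro; apply continuous_const]).
  - exact (conj Hc I).
  - assert (Z : forall t, Derive (fun _ : R => c) t = 0) by (intro; apply Derive_const).
    split; [exact Hc|].
    split; [intros t x y u; auto 6 using ex_derive_const|].
    split; [|split; [|split]];
      refine (eq_ind (fun _ _ _ _ => 0) (Ck n) (IH 0) _ _);
      apply fn4_ext; intros; symmetry; apply Z.
Qed.

Lemma Ck_plus n f g :
  Ck n f -> Ck n g -> Ck n (fun t x y u => f t x y u + g t x y u).
Proof.
  revert f g; induction n as [|n IH]; intros f g [Cf Hf] [Cg Hg];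
    assert (Hc : jointly_continuous (fun t x y u => f t x y u + g t x y u))
      by (eapply jointly_continuous_of_continuous;
          [|intro z; exact (continuous_plus _ _ z (Cf z) (Cg z))]; reflexivity).
  - exact (conj Hc I).
  - destruct Hf as (Pf & Ft & Fx & Fy & Fu), Hg as (Pg & Gt & Gx & Gy & Gu).
    split; [exact Hc|]. split.
    { intros t x y u.
      destruct (Pf t x y u) as (? & ? & ? & ?), (Pg t x y u) as (? & ? & ? & ?).
      split; [|split; [|split]]; apply (ex_derive_plus (V := R_NormedModule)); assumption. }
    split; [|split; [|split]];
      [refine (eq_ind _ (Ck n) (IH _ _ Ft Gt) _ _)
      |refine (eq_ind _ (Ck n) (IH _ _ Fx Gx) _ _)
      |refine (eq_ind _ (Ck n) (IH _ _ Fy Gy) _ _)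
      |refine (eq_ind _ (Ck n) (IH _ _ Fu Gu) _ _)];
      apply fn4_ext; intros t x y u; symmetry; apply Derive_plus;
      solve [apply (Pf t x y u) | apply (Pg t x y u)].
Qed.

(** By the product rule the induction hypothesis is applied to the factors
    themselves, which are of class C^(n+1). *)
Lemma Ck_mult n f g :
  Ck n f -> Ck n g -> Ck n (fun t x y u => f t x y u * g t x y u).
Proof.
  revert f g; induction n as [|n IH]; intros f g Kf Kg;
    pose proof Kf as [Cf Hf]; pose proof Kg as [Cg Hg];
    assert (Hc : jointly_continuous (fun t x y u => f t x y u * g t x y u))
      by (eapply jointly_continuous_of_continuous;
          [|intro z; exact (continuous_mult _ _ z (Cf z) (Cg z))]; reflexivity).
  - exact (conj Hc I).
  - apply Ck_of_Ck_S in Kf; apply Ck_of_Ck_S in Kg.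
    destruct Hf as (Pf & Ft & Fx & Fy & Fu), Hg as (Pg & Gt & Gx & Gy & Gu).
    split; [exact Hc|]. split.
    { intros t x y u.
      destruct (Pf t x y u) as (? & ? & ? & ?), (Pg t x y u) as (? & ? & ? & ?).
      split; [|split; [|split]]; apply ex_derive_mult; assumption. }
    split; [|split; [|split]];
      [refine (eq_ind _ (Ck n) (Ck_plus n _ _ (IH _ _ Ft Kg) (IH _ _ Kf Gt)) _ _)
      |refine (eq_ind _ (Ck n) (Ck_plus n _ _ (IH _ _ Fx Kg) (IH _ _ Kf Gx)) _ _)
      |refine (eq_ind _ (Ck n) (Ck_plus n _ _ (IH _ _ Fy Kg) (IH _ _ Kf Gy)) _ _)
      |refine (eq_ind _ (Ck n) (Ck_plus n _ _ (IH _ _ Fu Kg) (IH _ _ Kf Gu)) _ _)];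
      apply fn4_ext; intros t x y u; symmetry; apply Derive_mult;
      solve [apply (Pf t x y u) | apply (Pg t x y u)].
Qed.

Lemma smooth_plus f g :
  smooth f -> smooth g -> smooth (fun t x y u => f t x y u + g t x y u).
Proof. intros Hf Hg n; apply Ck_plus; auto. Qed.

Lemma smooth_mult f g :
  smooth f -> smooth g -> smooth (fun t x y u => f t x y u * g t x y u).
Proof. intros Hf Hg n; apply Ck_mult; auto. Qed.

(** One argument for all four coordinates: only their joint continuity differs. *)
Lemma smooth_coordinate (f : fn4) (ct cx cy cu : R) :
  f = (fun t x y u => ct * t + cx * x + cy * y + cu * u) ->
  jointly_continuous f -> smooth f.
Proof.
  intros Hf Hc; apply smooth_of_partials; [exact Hc|..]; rewrite Hf.
  - intros t x y u; split; [|split; [|split]]; auto_derive; exact I.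
  - refine (eq_ind _ smooth (smooth_const ct) _ _); apply fn4_ext; intros;
      symmetry; apply is_derive_unique; auto_derive; [trivial | ring].
  - refine (eq_ind _ smooth (smooth_const cx) _ _); apply fn4_ext; intros;
      symmetry; apply is_derive_unique; auto_derive; [trivial | ring].
  - refine (eq_ind _ smooth (smooth_const cy) _ _); apply fn4_ext; intros;
      symmetry; apply is_derive_unique; auto_derive; [trivial | ring].
  - refine (eq_ind _ smooth (smooth_const cu) _ _); apply fn4_ext; intros;
      symmetry; apply is_derive_unique; auto_derive; [trivial | ring].
Qed.

Lemma smooth_t : smooth (fun t _ _ _ => t).
Proof.
  apply (smooth_coordinate _ 1 0 0 0); [apply fn4_ext; intros; ring|].
  apply (jointly_continuous_of_continuous _ (fun z => fst (fst (fst z)))); [reflexivity|].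
  intros [[[t x] y] u].
  apply (continuous_comp (fun z : R * R * R * R => fst (fst z)) fst);
    [apply (continuous_comp fst fst)|]; apply continuous_fst.
Qed.

Lemma smooth_x : smooth (fun _ x _ _ => x).
Proof.
  apply (smooth_coordinate _ 0 1 0 0); [apply fn4_ext; intros; ring|].
  apply (jointly_continuous_of_continuous _ (fun z => snd (fst (fst z)))); [reflexivity|].
  intros [[[t x] y] u].
  apply (continuous_comp (fun z : R * R * R * R => fst (fst z)) snd);
    [apply (continuous_comp fst fst); apply continuous_fst | apply continuous_snd].
Qed.

Lemma smooth_y : smooth (fun _ _ y _ => y).
Proof.
  apply (smooth_coordinate _ 0 0 1 0); [apply fn4_ext; intros; ring|].
  apply (jointly_continuous_of_continuous _ (fun z => snd (fst z))); [reflexivity|].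
  intros [[[t x] y] u].
  apply (continuous_comp fst snd); [apply continuous_fst | apply continuous_snd].
Qed.

Lemma smooth_u : smooth (fun _ _ _ u => u).
Proof.
  apply (smooth_coordinate _ 0 0 0 1); [apply fn4_ext; intros; ring|].
  apply (jointly_continuous_of_continuous _ (fun z => snd z)); [reflexivity|].
  intros [[[t x] y] u]; apply continuous_snd.
Qed.

(** * The explicit symmetries *)

Lemma smooth_FK_field b p q t0 t1 r al be :
  smooth_vfield (FK_field b p q t0 t1 r al be).
Proof.
  set (L := fun c0 ct cx cy : R => fun t x y (_ : R) => c0 + ct * t + cx * x + cy * y).
  assert (HL : forall c0 ct cx cy, smooth (L c0 ct cx cy)).
  { intros; unfold L.
    apply (smooth_plus (fun t x _ _ => _ + _ * t + _ * x) (fun _ _ y _ => _ * y));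
      [apply (smooth_plus (fun t _ _ _ => _ + _ * t) (fun _ x _ _ => _ * x));
       [apply (smooth_plus (fun _ _ _ _ => _) (fun t _ _ _ => _ * t));
        [apply smooth_const|]|]|];
      (apply (smooth_mult (fun _ _ _ _ => _)); [apply smooth_const|]);
      [apply smooth_t | apply smooth_x | apply smooth_y]. }
  set (k := b * (p * t1 + 2 * q * r)); set (l := b * (q * t1 - 2 * p * r)).
  split; [|split; [|split]].
  - refine (eq_ind _ smooth (HL t0 t1 0 0) _ _); apply fn4_ext; intros; unfold L; cbn; ring.
  - refine (eq_ind _ smooth (HL al k (t1 / 2) (- r)) _ _);
      apply fn4_ext; intros; unfold L, k; cbn; ring.
  - refine (eq_ind _ smooth (HL be l r (t1 / 2)) _ _);
      apply fn4_ext; intros; unfold L, l; cbn; ring.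
  - refine (eq_ind _ smooth (smooth_mult _ _
      (HL (- (p * al + q * be + t1)) (- (p * k + q * l))
          (- (p * (t1 / 2) + q * r)) (- (q * (t1 / 2) - p * r))) smooth_u) _ _);
      apply fn4_ext; intros; unfold L, k, l; cbn; ring.
Qed.

Ltac explicit_partial :=
  apply fn4_ext; intros; apply is_derive_unique;
  repeat match goal with v := _ |- _ => progress unfold v end;
  cbn; auto_derive; [trivial | field].

(** On solutions of the equation the criterion reduces to - k t1 u = 0. *)
Lemma symmetry_FK_field a b m1 n1 p q t0 t1 r al be :
  (a + b * (p ^ 2 + q ^ 2)) * t1 = 0 ->
  symmetry_generator a b (fun x => m1 * exp (p * x)) (fun y => n1 * exp (q * y))
    (FK_field b p q t0 t1 r al be).
Proof.
  intro Hk; pose proof (smooth_FK_field b p q t0 t1 r al be) as HW.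
  split; [exact HW|]; intros j Hj.
  rewrite pr2_FKDelta, phi1_eq, !phi2_eq by exact HW.
  assert (Ut : j c_ut = a * j c_u
    - m1 * exp (p * j c_x) * (n1 * exp (q * j c_y)) * j c_u ^ 2
    + b * (j c_uxx + j c_uyy)) by (unfold FKDelta in Hj; lra).
  set (K := m1 * exp (p * j c_x) * (n1 * exp (q * j c_y))) in *.
  set (W := FK_field b p q t0 t1 r al be).
  set (ct := - b * (p ^ 2 + q ^ 2) * t1).
  set (cx := - (p * t1 / 2 + q * r)); set (cy := - (q * t1 / 2 - p * r)).
  pose (c := fun t x y => - (p * (t1 / 2 * x - r * y + b * (p * t1 + 2 * q * r) * t + al)
    + q * (t1 / 2 * y + r * x + b * (q * t1 - 2 * p * r) * t + be) + t1)).
  assert (tau_t : pd_t (tau W) = fun _ _ _ _ => t1) by explicit_partial.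
  assert (tau_x : pd_x (tau W) = fun _ _ _ _ => 0) by explicit_partial.
  assert (tau_y : pd_y (tau W) = fun _ _ _ _ => 0) by explicit_partial.
  assert (tau_u : pd_u (tau W) = fun _ _ _ _ => 0) by explicit_partial.
  assert (xi_t : pd_t (xix W) = fun _ _ _ _ => b * (p * t1 + 2 * q * r)) by explicit_partial.
  assert (xi_x : pd_x (xix W) = fun _ _ _ _ => t1 / 2) by explicit_partial.
  assert (xi_y : pd_y (xix W) = fun _ _ _ _ => - r) by explicit_partial.
  assert (xi_u : pd_u (xix W) = fun _ _ _ _ => 0) by explicit_partial.
  assert (eta_t : pd_t (xiy W) = fun _ _ _ _ => b * (q * t1 - 2 * p * r)) by explicit_partial.
  assert (eta_x : pd_x (xiy W) = fun _ _ _ _ => r) by explicit_partial.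
  assert (eta_y : pd_y (xiy W) = fun _ _ _ _ => t1 / 2) by explicit_partial.
  assert (eta_u : pd_u (xiy W) = fun _ _ _ _ => 0) by explicit_partial.
  assert (phi_t : pd_t (phi W) = fun _ _ _ u => ct * u) by explicit_partial.
  assert (phi_x : pd_x (phi W) = fun _ _ _ u => cx * u) by explicit_partial.
  assert (phi_y : pd_y (phi W) = fun _ _ _ u => cy * u) by explicit_partial.
  assert (phi_u : pd_u (phi W) = fun t x y _ => c t x y) by explicit_partial.
  assert (phi_xx : pd_x (fun _ _ _ u => cx * u) = fun _ _ _ _ => 0) by explicit_partial.
  assert (phi_xu : pd_u (fun _ _ _ u => cx * u) = fun _ _ _ _ => cx) by explicit_partial.
  assert (phi_yy : pd_y (fun _ _ _ u => cy * u) = fun _ _ _ _ => 0) by explicit_partial.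
  assert (phi_yu : pd_u (fun _ _ _ u => cy * u) = fun _ _ _ _ => cy) by explicit_partial.
  assert (phi_ux : pd_x (fun t x y _ => c t x y) = fun _ _ _ _ => cx) by explicit_partial.
  assert (phi_uy : pd_y (fun t x y _ => c t x y) = fun _ _ _ _ => cy) by explicit_partial.
  assert (phi_uu : pd_u (fun t x y _ => c t x y) = fun _ _ _ _ => 0) by explicit_partial.
  assert (Zx : forall d : R, pd_x (fun _ _ _ _ => d) = fun _ _ _ _ => 0)
    by (intro; explicit_partial).
  assert (Zy : forall d : R, pd_y (fun _ _ _ _ => d) = fun _ _ _ _ => 0)
    by (intro; explicit_partial).
  assert (Zu : forall d : R, pd_u (fun _ _ _ _ => d) = fun _ _ _ _ => 0)
    by (intro; explicit_partial).
  unfold D2, D1; cbn [partial base jet1 jet2].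
  rewrite ?tau_t, ?tau_x, ?tau_y, ?tau_u, ?xi_t, ?xi_x, ?xi_y, ?xi_u,
    ?eta_t, ?eta_x, ?eta_y, ?eta_u, ?phi_t, ?phi_x, ?phi_y, ?phi_u,
    ?phi_xx, ?phi_xu, ?phi_yy, ?phi_yu, ?phi_ux, ?phi_uy, ?phi_uu, ?Zx, ?Zy, ?Zu.
  unfold lift; rewrite Ut; cbn [W FK_field tau xix xiy phi]; unfold ct, cx, cy, c.
  transitivity (- ((a + b * (p ^ 2 + q ^ 2)) * t1) * j c_u);
    [field | rewrite Hk; ring].
Qed.

(** * The spans *)

Lemma in_span_nil V : in_span [] V <-> V = vzero.
Proof.
  split; [inversion 1; reflexivity | intros ->; constructor].
Qed.

Lemma in_span_cons_iff X Xs V :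
  in_span (X :: Xs) V <-> exists c W, in_span Xs W /\ V = vadd (vscale c X) W.
Proof.
  split; [inversion 1; subst; eauto | intros (c & W & HW & ->); constructor; exact HW].
Qed.

Lemma in_span_generic b p q V :
  in_span [X1; X2 p; X2' q; X3 b p q] V <->
  exists t0 r al be, V = FK_field b p q t0 0 r al be.
Proof.
  assert (E : forall c1 c2 c2' c3,
    vadd (vscale c1 X1) (vadd (vscale c2 (X2 p)) (vadd (vscale c2' (X2' q))
      (vadd (vscale c3 (X3 b p q)) vzero))) = FK_field b p q c1 0 c3 c2 c2').
  { intros; unfold vadd, vscale, FK_field; cbn;
      f_equal; apply fn4_ext; intros; field. }
  split.
  - intro H.
    repeat (apply in_span_cons_iff in H; destruct H as (? & ? & H & ->)).
    apply in_span_nil in H; subst; rewrite E; eauto.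
  - intros (t0 & r & al & be & ->); rewrite <- E; repeat constructor.
Qed.

(** The shifts of [al] and [be] are the multiples of X2 and X2' contained in X4. *)
Lemma in_span_special b p q V :
  in_span [X1; X2 p; X2' q; X3 b p q; X4 b p q] V <->
  exists t0 r al be s,
    V = FK_field b p q t0 (p * q * s) r (al - q / 2 * s) (be - p / 2 * s).
Proof.
  assert (E : forall c1 c2 c2' c3 c4,
    vadd (vscale c1 X1) (vadd (vscale c2 (X2 p)) (vadd (vscale c2' (X2' q))
      (vadd (vscale c3 (X3 b p q)) (vadd (vscale c4 (X4 b p q)) vzero)))) =
    FK_field b p q c1 (p * q * c4) c3 (c2 - q / 2 * c4) (c2' - p / 2 * c4)).
  { intros; unfold vadd, vscale, FK_field; cbn;
      f_equal; apply fn4_ext; intros; field. }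
  split.
  - intro H.
    repeat (apply in_span_cons_iff in H; destruct H as (? & ? & H & ->)).
    apply in_span_nil in H; subst; rewrite E; eauto 6.
  - intros (t0 & r & al & be & s & ->); rewrite <- E; repeat constructor.
Qed.

Theorem mainTheorem1 (a b m1 n1 p q : R)
  (ha : a <> 0) (hb : b <> 0) (hm1 : m1 <> 0) (hn1 : n1 <> 0) :
  let M := fun x : R => m1 * exp (p * x) in
  let N := fun y : R => n1 * exp (q * y) in
  (a <> - b * (p ^ 2 + q ^ 2) ->
     forall V : vfield,
       symmetry_generator a b M N V <->
       in_span [X1; X2 p; X2' q; X3 b p q] V) /\
  (a = - b * (p ^ 2 + q ^ 2) ->
     (forall V : vfield,
        in_span [X1; X2 p; X2' q; X3 b p q; X4 b p q] V ->
        symmetry_generator a b M N V) /\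
     (p <> 0 -> q <> 0 ->
      forall V : vfield,
        symmetry_generator a b M N V ->
        in_span [X1; X2 p; X2' q; X3 b p q; X4 b p q] V)).
Proof.
  intros M N; split.
  - intros hk V; rewrite in_span_generic; split.
    + intro HV.
      destruct (symmetry_normal_form a b m1 n1 p q V hb hm1 hn1 HV)
        as (t0 & t1 & r & al & be & Ht1 & ->).
      apply Rmult_integral in Ht1; destruct Ht1 as [Hk | ->]; [lra | eauto].
    + intros (t0 & r & al & be & ->); apply symmetry_FK_field; ring.
  - intros hk; split.
    + intros V HV; apply in_span_special in HV.
      destruct HV as (t0 & r & al & be & s & ->).
      apply symmetry_FK_field; rewrite hk; ring.
    + intros hp hq V HV; apply in_span_special.
      destruct (symmetry_normal_form a b m1 n1 p q V hb hm1 hn1 HV)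
        as (t0 & t1 & r & al & be & _ & ->).
      (* The coefficient of X4 must be t1 / (p q), as X4 has tau = p q t. *)
      exists t0, r, (al + q / 2 * (t1 / (p * q))), (be + p / 2 * (t1 / (p * q))), (t1 / (p * q)).
      f_equal; field; auto.
Qed.
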